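(* Let $\Omega\subset\mathbb{R}$ be open and bounded, $\mathbb{T}=\mathbb{R}/2\pi\mathbb{Z}$, let $\omega=H_0':\Omega\to\mathbb{R}$ be the frequency map of an integrable Hamiltonian $H(I,\theta)=H_0(I)$ on $\Omega\times\mathbb{T}$, and assume the nonresonance condition $k\,\omega(I)\neq 2m\pi$ for all $k\in\mathbb{Z}\setminus\{0\}$, $m\in\mathbb{Z}$, $I\in\Omega$. Let $G\in C_b(\Omega\times\mathbb{T})$ and let $c>0$ be a constant. Let $(X_j)_{j\ge1}$ be a real stochastic process independent of $(I,\theta)$ such that for every $k\in\mathbb{Z}\setminus\{0\}$ $$\frac1N\sum_{j=1}^N\big|a_j^{(k)}\big|\longrightarrow0\quad(N\to\infty),\qquad a_j^{(k)}:=\mathbb{E}\big(e^{\mathrm{i}ckX_j}\big).$$ Let $\mathcal{S}_{H_0}^{j}(I,\theta)=(I,\theta+j\,\omega(I)+cX_j)$, and let the initial point $(I,\theta)$ have probability density $\rho_0\in L^2(\Omega\times\mathbb{T})$. Then $$\lim_{N\to\infty}\mathbb{E}\big(V_N(\langle G\rangle_{\mathcal{S}})\big)=\langle\bar G(I)\rangle_0,\qquad \bar G(I)=\frac1{2\pi}\int_{\mathbb{T}}G(I,\theta)\,d\theta .$$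
   Context: $V_N(\langle G\rangle_{\mathcal{S}})=\frac1N\sum_{j=1}^N\int_{\Omega\times\mathbb{T}}G(\mathcal{S}_{H_0}^{j}(I,\theta))\,\rho_0(I,\theta)\,dI\,d\theta$, a random variable depending on $(X_j)$; $\mathbb{E}$ is the expectation over the process $(X_j)$. $\langle\bar G(I)\rangle_0=\int_{\Omega\times\mathbb{T}}\bar G(I)\,\rho_0(I,\theta)\,dI\,d\theta$. $C_b$ denotes bounded continuous (possibly complex-valued) functions. *)

(* Defs.v *)
From HB Require Import structures.
From mathcomp Require Import all_boot all_order all_algebra.
From mathcomp Require Import complex.
From mathcomp Require Import all_classical all_reals all_analysis.

Set Implicit Arguments.
Unset Strict Implicit.
Unset Printing Implicit Defensive.

Import Order.TTheory GRing.Theory Num.Theory.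
Import numFieldNormedType.Exports.

Local Open Scope classical_set_scope.
Local Open Scope ring_scope.
Local Open Scope complex_scope.

Definition expi {R : realType} (t : R) : R[i] := cos t +i* sin t.

Definition cintegral {d} {T : measurableType d} {R : realType}
    (mu : {measure set T -> \bar R}) (D : set T) (f : T -> R[i]) : R[i] :=
  Rintegral mu D (fun x => complex.Re (f x)) +i*
  Rintegral mu D (fun x => complex.Im (f x)).

Definition cexpectation {d} {T : measurableType d} {R : realType}
    (P : probability T R) (Y : T -> R[i]) : R[i] :=
  fine 'E_P[fun w => complex.Re (Y w)] +i* fine 'E_P[fun w => complex.Im (Y w)].

(** The circle [T = R / 2 pi Z] is handled through angles: a function on
    [Omega x T] is a function of [(I, theta)] in [Omega x R] that is
    [2 pi]-periodic in [theta], and integration over [Omega x T] is Lebesgue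
    integration over the fundamental domain [Omega x [0, 2 pi[].  Functions are
    total on [R * R]; their values off [Omega x R] are irrelevant. *)
Definition circle {R : realType} : set R := [set` `[0, 2 * pi[%R].

Definition phase_space {R : realType} (Omega : set R) : set (R * R) :=
  Omega `*` circle.

Notation phase_measure :=
  ((@lebesgue_measure _ \x @lebesgue_measure _)%E).

Definition angle_periodic {R : realType} {U : Type} (Omega : set R)
    (f : R * R -> U) : Prop :=
  forall I theta, Omega I -> f (I, theta + 2 * pi) = f (I, theta).

(** [C_b(Omega x T)]: continuity on [Omega x T] is continuity of the periodic
    lift on [Omega x R].  The alias [R[i]^o] carries the topology of [R[i]]. *)
Definition phase_Cb {R : realType} (Omega : set R) (G : R * R -> R[i]) : Prop :=
  [/\ angle_periodic Omega G,
      {within Omega `*` [set: R], continuous (G : R * R -> R[i]^o)} &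
      [bounded (G x : R[i]^o) | x in Omega `*` [set: R]]].

Definition L2_density {R : realType} (Omega : set R) (rho : R * R -> R) : Prop :=
  [/\ angle_periodic Omega rho,
      forall x, phase_space Omega x -> 0 <= rho x,
      rho \_ (phase_space Omega) \in Lfun phase_measure 2%:E &
      (\int[phase_measure]_(x in phase_space Omega) (rho x)%:E = 1)%E].

(** [Z] is valued in the fundamental domain almost surely. *)
Definition has_density {d} {W : measurableType d} {R : realType}
    (P : probability W R) (Omega : set R) (Z : {RV P >-> (R * R)%type})
    (rho : R * R -> R) : Prop :=
  forall B : set (R * R), measurable B ->
    distribution P Z B =
    (\int[phase_measure]_(x in B `&` phase_space Omega) (rho x)%:E)%E.

(** A process [(X_j)_{j >= 1}] is a sequence whose term of index [0] is ignored. *)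
Definition process_sigma {d} {W : measurableType d} {R : realType}
    (P : probability W R) (X : nat -> {RV P >-> R}) : set_system W :=
  <<s [set A | exists j (B : set R),
         [/\ (1 <= j)%N, measurable B & A = X j @^-1` B]] >>.

Definition process_independent {d} {W : measurableType d} {R : realType}
    (P : probability W R) (X : nat -> {RV P >-> R}) (Z : {RV P >-> (R * R)%type}) :
    Prop :=
  forall (A : set W) (B : set (R * R)), process_sigma X A -> measurable B ->
    P (A `&` Z @^-1` B) = (P A * P (Z @^-1` B))%E.

(** The [j]-th iterate, [x] being the value of [X_j]. *)
Definition time_map {R : realType} (omega : R -> R) (c : R) (j : nat) (x : R)
    (z : R * R) : R * R :=
  (z.1, z.2 + j%:R * omega z.1 + c * x).

Definition phase_average {R : realType} (Omega : set R) (rho : R * R -> R)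
    (F : R * R -> R[i]) : R[i] :=
  cintegral phase_measure (phase_space Omega) (fun z => F z * (rho z)%:C).

Definition time_average {d} {W : measurableType d} {R : realType}
    (P : probability W R) (Omega : set R) (omega : R -> R) (c : R)
    (X : nat -> {RV P >-> R}) (rho : R * R -> R) (G : R * R -> R[i])
    (N : nat) (w : W) : R[i] :=
  N%:R^-1 * \sum_(1 <= j < N.+1)
    phase_average Omega rho (fun z => G (time_map omega c j (X j w) z)).

Definition angle_average {R : realType} (G : R * R -> R[i]) (I : R) : R[i] :=
  ((2 * pi)^-1)%:C *
  cintegral (@lebesgue_measure R) circle (fun theta => G (I, theta)).

Definition char_coeff {d} {W : measurableType d} {R : realType}
    (P : probability W R) (c : R) (X : nat -> {RV P >-> R}) (k : int)
    (j : nat) : R[i] :=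
  cexpectation P (fun w => expi (c * k%:~R * X j w)).

(* Main.v *)
Require Import Defs.
From HB Require Import structures.
From mathcomp Require Import all_boot all_order all_algebra.
From mathcomp Require Import complex ring lra zify.
From mathcomp Require Import all_classical all_reals all_analysis measurable_realfun.

Set Implicit Arguments.
Unset Strict Implicit.
Unset Printing Implicit Defensive.

Import Order.TTheory GRing.Theory Num.Theory.
Import numFieldNormedType.Exports.

Local Open Scope classical_set_scope.
Local Open Scope ring_scope.
Local Open Scope complex_scope.

(** By Fubini the quantity to control is the [rho0]-average over [(I, theta)] of
    [N^-1 * \sum_j E (G (I, theta + j omega(I) + c X_j))], so by dominated convergence it
    is enough to treat a fixed [(I, theta)], i.e. a Weyl criterion for a continuous
    periodic function [g = G (I, .)].  Sampling [g] at the [n] points [2 pi m / n] against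
    the Fejer kernel approximates [g] uniformly by trigonometric polynomials, and on
    those the hypothesis on the coefficients [a_j^(k)] applies directly, whatever the
    phases [theta + j omega(I)] are. *)

(** * Fejer approximation *)

(** Sampling replaces convolution integrals and Fourier coefficients: for each [n] the approximant
    is a finite combination of shifted cosines [cos (p * (t - a))], so a functional that is only
    additive, homogeneous and bounded by the sup norm passes through it. Everything stays real, the
    shift [a] doing the work of the sine terms. The phases are harmless because the expectation of
    [cos (p * (c X_j - a))] is at most twice the modulus of [a_j^(p)] for every [a]; the shift may
    therefore depend on [j], [I] and [theta]. The obstacle in the Fubini step is joint
    measurability. The frequency map is only known as a derivative, possibly discontinuous, and [G]
    is controlled only over [Omega]. Hence the passage through difference quotients, the extensions
    by zero, and the comparison of open sets of the plane with the product sigma-algebra. *)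

Lemma periodicz {U V : zmodType} (f : U -> V) (T : U) :
  periodic f T -> forall (p : int) a, f (a + T *~ p) = f a.
Proof.
move=> fT [n|n] a; first exact: periodicn.
by rewrite NegzE mulrNz -(periodicn fT n.+1 (a - _)) subrK.
Qed.

(** The classical kernel, the sum over [|p| < n] of [(1 - |p| / n) cos (p t)]. The double sum
    displays it as a combination of cosines of integer frequencies below [n]; [fejerE] rewrites it
    as [|1 + e^{it} + ... + e^{i(n-1)t}|^2 / n], which gives the sign. *)
Definition fejer {R : realType} (n : nat) (t : R) : R :=
  n%:R^-1 * \sum_(k < n) \sum_(l < n) cos ((k%:Z - l%:Z)%:~R * t).

Lemma fejerE {R : realType} (n : nat) (t : R) :
  fejer n t = n%:R^-1 * ((\sum_(k < n) cos (k%:R * t)) ^+ 2 +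
                         (\sum_(k < n) sin (k%:R * t)) ^+ 2).
Proof.
rewrite /fejer; congr (_ * _); rewrite !expr2 !mulr_suml -big_split/=.
apply: eq_bigr => k _; rewrite !mulr_sumr -big_split/=.
by apply: eq_bigr => l _; rewrite intrB mulrBl cosB.
Qed.

Lemma fejer_ge0 {R : realType} (n : nat) (t : R) : 0 <= fejer n t.
Proof. by rewrite fejerE mulr_ge0// addr_ge0 ?sqr_ge0. Qed.

(** Since [|1 - e^{it}|^2 = 2 (1 - cos t)], the geometric sum gives
    [(1 - cos t) |sum|^2 = 1 - cos (n t) <= 2]. The product form avoids dividing by [1 - cos t] and
    matches the error term of [periodic_modulus]. *)
Lemma fejer_concentrated {R : realType} (n : nat) (t : R) :
  (1 - cos t) * fejer n t <= 2 / n%:R.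
Proof.
rewrite fejerE; set C := \sum_(k < n) cos _; set S := \sum_(k < n) sin _.
(* (C + iS)(1 - e^{it}) = 1 - e^{int}; compare squared moduli. *)
have CE : C * (1 - cos t) + S * sin t = 1 - cos (n%:R * t).
  rewrite /C /S; elim: n {C S} => [|n IH].
    by rewrite !big_ord0 !mul0r cos0 subrr addr0.
  rewrite !big_ord_recr/= (_ : n.+1%:R * t = n%:R * t + t); last first.
    by rewrite -natr1; ring.
  by rewrite cosD; lra.
have SE : S * (1 - cos t) - C * sin t = - sin (n%:R * t).
  rewrite /C /S {CE}; elim: n {C S} => [|n IH].
    by rewrite !big_ord0 !mul0r sin0 subr0 oppr0.
  rewrite !big_ord_recr/= (_ : n.+1%:R * t = n%:R * t + t); last first.
    by rewrite -natr1; ring.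
  by rewrite sinD; lra.
have le2 : (1 - cos t) * (C ^+ 2 + S ^+ 2) <= 2.
  have h1 := cos2Dsin2 t; have h2 := cos2Dsin2 (n%:R * t).
  have h3 := cos_geN1 (n%:R * t).
  have : (C * (1 - cos t) + S * sin t) ^+ 2 + (S * (1 - cos t) - C * sin t) ^+ 2
    = (C ^+ 2 + S ^+ 2) * (1 - 2 * cos t + (cos t ^+ 2 + sin t ^+ 2)) by ring.
  rewrite CE SE h1 sqrrN sqrrB => h4.
  by rewrite mulrC; nra.
by rewrite mulrCA [leRHS]mulrC ler_wpM2l.
Qed.

(** Orthogonality of characters on the [n]-th roots of unity. The bound on [p] excludes aliasing,
    that is, nonzero multiples of [n]. *)
Lemma sum_cos_roots {R : realType} (n : nat) (p : int) (x : R) :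
  (`|p| < n)%N ->
  \sum_(m < n) cos (p%:~R * (x - 2 * pi * m%:R / n%:R)) = (p == 0)%:R * n%:R.
Proof.
move=> pn; have n0 : n%:R != 0 :> R by rewrite pnatr_eq0 -lt0n (leq_ltn_trans _ pn).
have [->|p0] := eqVneq p 0.
  rewrite (eq_bigr (fun=> 1)) ?mul1r ?sumr_const ?card_ord//.
  by move=> m _; rewrite mul0r cos0.
(* [h] is half the phase increment between samples: multiplying by [2 sin h] makes the sum
   telescope, and [0 < |h| < pi] makes [sin h] invertible. *)
rewrite mul0r; set h : R := pi * p%:~R / n%:R.
have sh : sin h != 0.
  have h0 : h != 0.
    by rewrite !mulf_neq0 ?invr_eq0 ?intr_eq0// gt_eqF// pi_gt0.
  rewrite [h]numEsg sin_sg mulf_neq0 ?sgr_eq0// gt_eqF// sin_gt0_pi// normr_gt0 h0/=.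
  rewrite !normrM normfV (gtr0_norm (pi_gt0 R)) normr_nat -mulrA gtr_pMr ?pi_gt0//.
  by rewrite ltr_pdivrMr ?mul1r ?ltr0n ?(leq_ltn_trans _ pn)// -intr_norm -abszE ltr_nat.
have tel N : 2 * sin h * \sum_(m < N) cos (p%:~R * (x - 2 * pi * m%:R / n%:R)) =
    sin (p%:~R * x + h) - sin (p%:~R * x + h - 2 * N%:R * h).
  elim: N => [|N IH]; first by rewrite big_ord0 !(mulr0, mul0r) subr0 subrr.
  rewrite big_ord_recr/= mulrDr IH.
  set a := p%:~R * (x - _).
  rewrite (_ : p%:~R * x + h - 2 * N%:R * h = a + h); last by rewrite /a /h; field.
  rewrite (_ : _ - 2 * N.+1%:R * h = a - h).
    by rewrite (sinD a) (sinB a); ring.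
  by rewrite /a /h; field.
(* After [n] samples the phase has moved by [2 n h = 2 pi p], so the two end terms cancel. *)
have /eqP := tel n; rewrite (_ : 2 * n%:R * h = (2 * pi) *~ p); last first.
  by rewrite /h -mulrzr; field.
have p2pi : periodic sin (2 * pi : R) by move=> u; rewrite mulr_natl sinD2pi.
rewrite -mulrNz periodicz// subrr mulf_eq0 mulf_eq0 pnatr_eq0/= (negbTE sh)/=.
by move/eqP.
Qed.

(** All frequencies [k - l] have modulus below [n], so only the diagonal survives the sampling. With
    positivity, this turns the sampled approximant into a weighted mean of values of [g]. *)
Lemma fejer_sample_mean {R : realType} (n : nat) (x : R) : (0 < n)%N ->
  n%:R^-1 * \sum_(m < n) fejer n (x - 2 * pi * m%:R / n%:R) = 1.
Proof.
move=> n0; have nz : n%:R != 0 :> R by rewrite pnatr_eq0 -lt0n.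
rewrite -mulr_sumr exchange_big/= (eq_bigr (fun=> n%:R)) => [|k _].
  by rewrite sumr_const card_ord -[n%:R *+ n]mulr_natr mulKf// mulVf.
rewrite exchange_big/= (bigD1 k)//= sum_cos_roots ?subrr//= mul1r big1 ?addr0//.
move=> l lk; rewrite sum_cos_roots.
  rewrite subr_eq0 (_ : _ == _ = false) ?mul0r//.
  by apply/negP; rewrite eqz_nat => /eqP kl; move/eqP : lk; apply; exact/val_inj.
all: have := ltn_ord k; have := ltn_ord l; lia.
Qed.

(** * Uniform continuity of periodic functions *)

Lemma periodic_representative {R : realType} (T a x : R) : 0 < T ->
  exists p : int, a <= x + T *~ p < a + T.
Proof.
move=> T0; exists (- Num.floor ((x - a) / T)); set n := Num.floor _.
have /andP[h1 h2] : n%:~R <= (x - a) / T < n%:~R + 1.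
  by rewrite ge_floor/= -[1]/(1%:~R) -intrD lt_succ_floor.
have e : (x - a) / T * T = x - a by rewrite divfK// gt_eqF.
rewrite mulrNz -mulrzr; apply/andP; split.
  have : T * n%:~R <= x - a by rewrite mulrC -e ler_pM2r.
  by lra.
have : x - a < T * n%:~R + T by rewrite -{2}[T]mulr1 -mulrDr mulrC -{1}e ltr_pM2r.
by lra.
Qed.

(** Heine-Cantor by a covering argument, with [y] free to leave [K]: after reduction modulo the
    period only one of the two points is known to lie in the compact interval. *)
Lemma compact_uniform_modulus {R : realType} (K : set R) (g : R -> R) (e : R) :
  compact K -> continuous g -> 0 < e ->
  \forall d \near 0^'+, forall x, K x -> forall y, `|x - y| < d -> `|g x - g y| < e.
Proof.
move=> /compact_near_coveringP cK cg e0; apply: cK => x _.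
have e20 : 0 < e / 2 by rewrite divr_gt0.
have /cvgrPdist_lt /(_ _ e20)/nbhs_ballP[r /= r0 xr] := cg x.
have r20 : 0 < r / 2 by rewrite divr_gt0.
exists (ball x (r / 2), [set d | d < r / 2]) => /=.
  by split; [exact: nbhsx_ballx|exact: nbhs_right_lt].
move=> [x' d]/= [xx' dr] y x'y.
have h1 := xr x' (le_ball (ltW (_ : r / 2 < r)) xx').
have h2 : `|g x - g y| < e / 2.
  apply: xr; rewrite /ball/=.
  move: xx'; rewrite /ball/= => xx'.
  by rewrite (splitr r) (le_lt_trans (ler_distD x' _ _))// ltrD// (lt_trans x'y).
rewrite (splitr e) (le_lt_trans (ler_distD (g x) _ _))// ltrD//.
by rewrite distrC; apply: h1; rewrite ltr_pdivrMr// ltr_pMr// ltr1n.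
Qed.

(** At angular distance below [d], uniform continuity gives [e]. Farther away
    [1 - cos (x - y) >= 1 - cos d > 0], so the crude bound [2 * B] is absorbed by
    [C = 2 * B / (1 - cos d)]. *)
Lemma periodic_modulus {R : realType} (g : R -> R) (B e : R) :
  continuous g -> periodic g (2 * pi) -> (forall x, `|g x| <= B) -> 0 < e ->
  exists2 C : R, 0 <= C & forall x y, `|g x - g y| <= e + C * (1 - cos (x - y)).
Proof.
move=> cg pg gB e0.
have : \forall d \near (0:R)^'+, [/\ 0 < d, d < pi &
    forall x, `[0, 2 * pi]%classic x -> forall y, `|x - y| < d -> `|g x - g y| < e].
  near=> d; split; near: d.
  - exact: nbhs_right_gt.
  - by apply: nbhs_right_lt; exact: pi_gt0.
  - exact: compact_uniform_modulus (@segment_compact _ _ _) cg e0.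
move=> /filter_ex[d [d0 dpi gd]].
have cd : 0 < 1 - cos d.
  rewrite subr_gt0 -[ltRHS]cos0 ltr_cos// in_itv/= ?lexx ?pi_ge0//.
  by rewrite (ltW d0) ltW.
have B0 : 0 <= B by rewrite (le_trans _ (gB 0)).
exists (2 * B / (1 - cos d)); first by rewrite divr_ge0 ?mulr_ge0// ltW.
have T0 : 0 < 2 * pi :> R by rewrite mulr_gt0// pi_gt0.
have C2 : periodic cos (2 * pi : R) by move=> u; rewrite mulr_natl cosD2pi.
(* Translating [x] into [[0, 2 pi[] and then [y] to within [pi] of it makes [|x' - y'|] the angular
   distance, in the range where [cos] decreases. *)
move=> x y; have [p xp] := periodic_representative 0 x T0.
set x' := x + (2 * pi) *~ p in xp.
have [q yq] := periodic_representative (x' - pi) y T0.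
set y' := y + (2 * pi) *~ q in yq.
rewrite -(periodicz pg p x) -(periodicz pg q y) -(periodicz C2 (p - q) (x - y)).
rewrite -/x' -/y' (_ : x - y + _ = x' - y'); last by rewrite /x' /y' mulrzBr; ring.
have [xyd|dxy] := ltP `|x' - y'| d.
  apply: (@le_trans _ _ e).
    by apply/ltW/gd => //=; rewrite in_itv/=; lra.
  by rewrite lerDl mulr_ge0 ?subr_ge0 ?cos_le1// divr_ge0 ?mulr_ge0// ltW.
have xypi : `|x' - y'| <= pi by rewrite ler_norml; lra.
have cc : cos (x' - y') <= cos d.
  rewrite -cos_norm; move: dxy; rewrite le_eqVlt => /predU1P[->//|dxy].
  by rewrite ltW// ltr_cos// in_itv/= ?normr_ge0 ?(ltW d0) ?(ltW dpi).
apply: (@le_trans _ _ (2 * B)).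
  by rewrite (le_trans (ler_normB _ _))//; have := gB x'; have := gB y'; lra.
apply: (@le_trans _ _ (2 * B / (1 - cos d) * (1 - cos (x' - y')))); last by lra.
rewrite -mulrA ler_peMr ?mulr_ge0// mulrC ler_pdivlMr// mul1r; lra.
Unshelve. all: end_near. Qed.

(** By [fejer_sample_mean] the error is a kernel-weighted mean of the differences [g x - g a_m]. The
    constant part of the modulus contributes [e / 2], and its [1 - cos] part at most [2 * C / n] by
    concentration. *)
Lemma fejer_approximation {R : realType} (g : R -> R) (B e : R) :
  continuous g -> periodic g (2 * pi) -> (forall x, `|g x| <= B) -> 0 < e ->
  exists2 n : nat, (0 < n)%N & forall x,
    `|g x - n%:R^-1 * \sum_(m < n) g (2 * pi * m%:R / n%:R) *
                       fejer n (x - 2 * pi * m%:R / n%:R)| <= e.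
Proof.
move=> cg pg gB e0; have e20 : 0 < e / 2 by rewrite divr_gt0.
have [C C0 gC] := periodic_modulus cg pg gB e20.
(* This choice makes [2 * C / n] smaller than [e / 2]. *)
have [n ngt0 Cn] : exists2 n, (0 < n)%N & 4 * C / e < n%:R.
  by exists (Num.truncn (4 * C / e)).+1; rewrite ?truncnS_gt.
have n0 : 0 < n%:R :> R by rewrite ltr0n.
exists n => // x.
rewrite -[g x]mul1r -{1}(fejer_sample_mean x ngt0).
rewrite -mulrA -mulrBr mulr_suml -sumrB normrM ger0_norm ?invr_ge0//.
rewrite mulrC ler_pdivrMr// (le_trans (ler_norm_sum _ _ _))//.
pose a (m : 'I_n) : R := 2 * pi * m%:R / n%:R.
apply: (@le_trans _ _ (\sum_(m < n) (e / 2 * fejer n (x - a m) + C * (2 / n%:R)))).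
  apply: ler_sum => m _; rewrite -/(a m) [fejer _ _ * _]mulrC -mulrBl normrM.
  rewrite (ger0_norm (fejer_ge0 _ _)).
  apply: (le_trans (ler_wpM2r (fejer_ge0 _ _) (gC _ _))).
  by rewrite mulrDl lerD2l -mulrA ler_wpM2l// fejer_concentrated.
rewrite big_split/= -mulr_sumr sumr_const card_ord -[X in _ + X]mulr_natr.
have -> : \sum_(m < n) fejer n (x - a m) = n%:R.
  apply: (mulfI (_ : n%:R^-1 != 0)); first by rewrite invr_eq0 gt_eqF.
  by rewrite fejer_sample_mean// mulVf// gt_eqF.
have -> : C * (2 / n%:R) * n%:R = 2 * C by field; rewrite gt_eqF.
by move: Cn; rewrite ltr_pdivrMr//; lra.
Qed.

(** * A Weyl criterion *)

Definition cbounded {R : realType} (f : R -> R) :=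
  continuous f /\ exists B, forall x, `|f x| <= B.

(** Linear forms of norm at most 1 for the sup norm. The laws are restricted to [cbounded] arguments
    because integrals are additive only on integrable functions. *)
Definition bounded_functional {R : realType} (E : (R -> R) -> R) :=
  [/\ forall f g, cbounded f -> cbounded g ->
        E (fun x => f x + g x) = E f + E g,
      forall a f, cbounded f -> E (fun x => a * f x) = a * E f &
      forall f e, cbounded f -> (forall x, `|f x| <= e) -> `|E f| <= e].

Lemma cboundedD {R : realType} (f g : R -> R) :
  cbounded f -> cbounded g -> cbounded (fun x => f x + g x).
Proof.
move=> [cf [A fA]] [cg [B gB]]; split.
  by move=> x; apply: cvgD; [exact: cf|exact: cg].
by exists (A + B) => x; rewrite (le_trans (ler_normD _ _))// lerD.
Qed.

Lemma cboundedZ {R : realType} (a : R) (f : R -> R) :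
  cbounded f -> cbounded (fun x => a * f x).
Proof.
move=> [cf [A fA]]; split; first by move=> x; apply: cvgMr; exact: cf.
by exists (`|a| * A) => x; rewrite normrM ler_wpM2l.
Qed.

Lemma cbounded_cos {R : realType} (b a : R) :
  cbounded (fun t : R => cos (b * (t - a))).
Proof.
split; last by exists 1 => x; exact: cos_max.
move=> x; apply: continuous_comp; last exact: continuous_cos.
by apply: cvgMr; apply: cvgB; [exact: cvg_id|exact: cvg_cst].
Qed.

Section fejer_criterion.
Variables (R : realType) (E_ : nat -> (R -> R) -> R) (E : (R -> R) -> R).
Hypotheses (bE_ : forall N, bounded_functional (E_ N)) (bE : bounded_functional E).

(** The functions on which convergence is known form a vector space; [cbounded] is carried along
    because the linearity laws require it. *)
Let conv f := cbounded f /\ E_ ^~ f @ \oo --> E f.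

Let convD f g : conv f -> conv g -> conv (fun x => f x + g x).
Proof.
move=> [cf Ef] [cg Eg]; split; first exact: cboundedD.
have [ED _ _] := bE; rewrite ED//.
have -> : E_ ^~ (fun x => f x + g x) = E_ ^~ f \+ E_ ^~ g.
  by apply/funext => N; have [-> ] := bE_ N.
exact: cvgD.
Qed.

Let convZ a f : conv f -> conv (fun x => a * f x).
Proof.
move=> [cf Ef]; split; first exact: cboundedZ.
have [_ EZ _] := bE; rewrite EZ//.
have -> : E_ ^~ (fun x => a * f x) = (fun N => a * E_ N f).
  by apply/funext => N; have [_ -> ] := bE_ N.
exact: cvgMr.
Qed.

Let conv_sum n (F : 'I_n -> R -> R) :
  (forall i, conv (F i)) -> conv (fun x => \sum_(i < n) F i x).
Proof.
elim: n F => [|n IH] F cF.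
  have c0 : cbounded (fun=> 0 : R).
    by split; [move=> x; exact: cvg_cst|exists 0 => x; rewrite normr0].
  have e0 (E' : (R -> R) -> R) : bounded_functional E' -> E' (fun=> 0) = 0.
    move=> [_ _ /(_ _ 0 c0)/= h]; apply/eqP; rewrite -normr_le0 h// => x.
    by rewrite normr0.
  rewrite (_ : (fun x => _) = (fun=> 0)); last by apply/funext => x; rewrite big_ord0.
  split=> //; rewrite e0//; under eq_fun do rewrite e0//; exact: cvg_cst.
rewrite (_ : (fun x => _) =
    fun x => \sum_(i < n) F (widen_ord (leqnSn n) i) x + F ord_max x).
  by apply: convD => //; exact: IH.
by apply/funext => x; rewrite big_ord_recr.
Qed.

(** Convergence holds on the approximant [L] by linearity. The uniform error [e / 4] between [g] and
    [L] survives under [E] and under every [E_ N], so the three errors add up to less than [e]. *)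
Lemma fejer_criterion :
  (forall (p : int) a, E_ ^~ (fun t => cos (p%:~R * (t - a))) @ \oo -->
     E (fun t => cos (p%:~R * (t - a)))) ->
  forall g, cbounded g -> periodic g (2 * pi) -> E_ ^~ g @ \oo --> E g.
Proof.
move=> Ecos g cbg pg; have [cg [B gB]] := cbg.
have conv_fejer n a : conv (fun t => fejer n (t - a)).
  by do 3![apply: convZ || apply: conv_sum => ?]; split; [exact: cbounded_cos|].
apply/cvgrPdist_lt => e e0; have e40 : 0 < e / 4 by rewrite divr_gt0.
have [n n0 gn] := fejer_approximation cg pg gB e40.
pose L (x : R) : R := n%:R^-1 * \sum_(m < n) g (2 * pi * m%:R / n%:R) *
  fejer n (x - 2 * pi * m%:R / n%:R).
have [cL EL] : conv L.
  by apply: convZ; apply: conv_sum => m; apply: convZ; exact: conv_fejer.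
have cNL := cboundedZ (-1) cL.
have diff E' : bounded_functional E' -> `|E' g - E' L| <= e / 4.
  move=> [E'D E'Z E'b]; rewrite -[- _]mulN1r -E'Z// -E'D//.
  by apply: E'b => [|x]; [exact: cboundedD|rewrite mulN1r; exact: gn].
near=> N.
have h1 := diff _ bE; have h2 := diff _ (bE_ N).
have h3 : `|E L - E_ N L| < e / 4.
  by near: N; move/cvgrPdist_lt : EL; exact.
move: h1 h2 h3; rewrite !ler_norml !ltr_norml => /andP[? ?] /andP[? ?] /andP[? ?].
by apply/andP; split; lra.
Unshelve. all: end_near. Qed.

End fejer_criterion.

(** * Integrals as bounded functionals *)

Section integral_functionals.
Context {d : measure_display} {T : measurableType d} {R : realType}.
Variables (mu : {measure set T -> \bar R}) (D : set T).
Hypotheses (mD : measurable D) (fD : (mu D < +oo)%E).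

Lemma bounded_integrable (f : T -> R) (B : R) :
  measurable_fun D f -> (forall x, D x -> `|f x| <= B) ->
  mu.-integrable D (EFin \o f).
Proof.
move=> mf fB; apply: measurable_bounded_integrable => //.
exists B; split; first exact: num_real.
by move=> b Bb x Dx /=; rewrite (le_trans (fB x Dx))// ltW.
Qed.

Lemma normr_Rintegral_le (f : T -> R) (B : R) :
  measurable_fun D f -> (forall x, D x -> `|f x| <= B) ->
  `|\int[mu]_(x in D) f x| <= B * fine (mu D).
Proof.
move=> mf fB; have intf := bounded_integrable mf fB.
rewrite (le_trans (le_normr_Rintegral mD intf))// -Rintegral_cst//.
apply: le_Rintegral => //.
  by apply: (bounded_integrable (B := B)) => [|x Dx]; [exact: measurableT_comp|
    rewrite normr_id fB].
by apply: (bounded_integrable (B := `|B|)).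
Qed.

Lemma cbounded_comp_measurable (f : R -> R) (Y : T -> R) :
  cbounded f -> measurable_fun D Y -> measurable_fun D (f \o Y).
Proof.
by move=> [cf _] mY; apply: measurableT_comp => //; exact: continuous_measurable_fun.
Qed.

(** The factor [a] serves two normalisations: [1] for expectations and [1 / (2 pi)] for the mean
    over the circle. *)
Lemma bounded_functional_Rintegral (Y : T -> R) (a : R) :
  measurable_fun D Y -> 0 <= a -> a * fine (mu D) <= 1 ->
  bounded_functional (fun f => a * \int[mu]_(x in D) f (Y x)).
Proof.
move=> mY a0 a1.
have int f : cbounded f -> mu.-integrable D (EFin \o (f \o Y)).
  move=> cf; have [_ [B fB]] := cf.
  by apply: (bounded_integrable (B := B)) => [|x _ /=]; [exact: cbounded_comp_measurable|].
split=> [f g cf cg|b f cf|f e cf fe].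
- by rewrite RintegralD; [rewrite mulrDr|exact: mD|exact: int|exact: int].
- by rewrite RintegralZl; [rewrite mulrCA|exact: mD|exact: int].
- rewrite normrM ger0_norm//; have e0 : 0 <= e by rewrite (le_trans _ (fe 0)).
  have h := normr_Rintegral_le (cbounded_comp_measurable cf mY) (fun x _ => fe (Y x)).
  rewrite (le_trans (ler_wpM2l a0 h))//.
  by rewrite mulrCA -[leRHS]mulr1 ler_wpM2l.
Qed.

End integral_functionals.

Lemma bounded_functional_average {R : realType} (E_ : nat -> (R -> R) -> R) (N : nat) :
  (forall j, bounded_functional (E_ j)) ->
  bounded_functional (fun f => N%:R^-1 * \sum_(1 <= j < N.+1) E_ j f).
Proof.
move=> bE; split=> [f g cf cg|a f cf|f e cf fe].
- rewrite -mulrDr -big_split/=; congr (_ * _); apply: eq_bigr => j _.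
  by have [-> ] := bE j.
- rewrite [RHS]mulrCA; congr (_ * _); rewrite mulr_sumr; apply: eq_bigr => j _.
  by have [_ ->] := bE j.
- have e0 : 0 <= e by rewrite (le_trans _ (fe 0)).
  (* At [N = 0] the convention [0^-1 = 0] makes the average vanish. *)
  have [->|N0] := posnP N; first by rewrite invr0 mul0r normr0.
  rewrite normrM ger0_norm ?invr_ge0// mulrC ler_pdivrMr ?ltr0n//.
  rewrite (le_trans (ler_norm_sum _ _ _))//.
  apply: (@le_trans _ _ (\sum_(1 <= j < N.+1) e)).
    by apply: ler_sum => j _; have [_ _] := bE j; exact.
  by rewrite sumr_const_nat subn1 mulr_natr.
Qed.

(** * The mean over the circle *)

Lemma measurable_circle {R : realType} : measurable (@circle R).
Proof. exact: measurable_itv. Qed.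

Lemma lebesgue_measure_circle {R : realType} :
  lebesgue_measure (@circle R) = (2 * pi)%:E.
Proof.
rewrite /circle lebesgue_measure_itv/= lte_fin mulr_gt0 ?pi_gt0//.
by rewrite -EFinB subr0.
Qed.

Definition circle_mean {R : realType} (f : R -> R) : R :=
  (2 * pi)^-1 * \int[@lebesgue_measure R]_(x in circle) f x.

Lemma bounded_functional_circle_mean {R : realType} :
  bounded_functional (@circle_mean R).
Proof.
apply: (@bounded_functional_Rintegral _ _ R (@lebesgue_measure R) circle _ _ id).
- exact: measurable_circle.
- by rewrite [X in (X < _)%E]lebesgue_measure_circle ltry.
- by [].
- by rewrite invr_ge0 mulr_ge0// pi_ge0.
- by rewrite [X in fine X]lebesgue_measure_circle/= mulVf// mulf_neq0// gt_eqF// pi_gt0.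
Qed.

Lemma circle_mean_cos {R : realType} (p : int) (a : R) :
  circle_mean (fun t => cos (p%:~R * (t - a))) = (p == 0)%:R.
Proof.
have T0 : 0 < 2 * pi :> R by rewrite mulr_gt0 ?pi_gt0.
rewrite /circle_mean; have [->|p0] := eqVneq p 0.
  under eq_Rintegral do rewrite mul0r cos0.
  rewrite Rintegral_cst; last exact: measurable_circle.
  rewrite [X in fine X]lebesgue_measure_circle/= mul1r.
  by rewrite mulVf// gt_eqF.
have [cf _] := cbounded_cos p%:~R a; set f := fun t => _ in cf *.
have pR0 : p%:~R != 0 :> R by rewrite intr_eq0.
(* An antiderivative of the cosine; its values at [0] and [2 pi] agree because [p] is an integer. *)
pose F (t : R) := p%:~R^-1 * sin (p%:~R * (t - a)).
have dF (x : R) : is_derive x 1 F (f x).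
  rewrite /F; apply: is_derive_eq; rewrite /GRing.scale/=.
  by rewrite /f; field.
have cF (x : R) : {for x, continuous F}.
  by apply: differentiable_continuous; apply/derivable1_diffP; have [] := dF x.
(* The fundamental theorem of calculus applies on the closed interval, which differs from the circle
   by a null point. *)
rewrite Rintegral_itv_bndo_bndc; last first.
  apply: (@bounded_integrable _ _ R _ _ _ _ _ 1) => //.
  - by rewrite [X in (X < _)%E]lebesgue_measure_circle ltry.
  - exact: measurable_funS (continuous_measurable_fun cf).
  - by move=> x _; exact: cos_max.
rewrite /Rintegral (continuous_FTC2 T0 (F := F)).
- rewrite -EFinB/= /F (_ : p%:~R * (2 * pi - a) = p%:~R * (0 - a) + (2 * pi) *~ p).
    by rewrite periodicz ?subrr ?mulr0// => u; rewrite mulr_natl sinD2pi.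
  by rewrite -mulrzr; ring.
- exact: continuous_subspaceT.
- split.
  + by move=> x _; have [] := dF x.
  + exact/cvg_at_right_filter/cF.
  + exact/cvg_at_left_filter/cF.
- by move=> x _; rewrite derive1E; have [] := dF x.
Qed.

(** * Averages along the process *)

Lemma Re_le_normc {R : realType} (z : R[i]) :
  `|complex.Re z| <= ComplexField.Normc.normc z.
Proof.
by case: z => x y /=; rewrite -sqrtr_sqr ler_sqrt ?lerDl ?addr_ge0 ?sqr_ge0.
Qed.

Lemma Im_le_normc {R : realType} (z : R[i]) :
  `|complex.Im z| <= ComplexField.Normc.normc z.
Proof.
by case: z => x y /=; rewrite -sqrtr_sqr ler_sqrt ?lerDr ?addr_ge0 ?sqr_ge0.
Qed.

Section weyl_criterion.
Context {d : measure_display} {W : measurableType d} {R : realType}.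
Variables (P : probability W R) (c : R) (X : nat -> {RV P >-> R}).

Let PT_fin : (P setT < +oo)%E.
Proof. by rewrite probability_setT ltry. Qed.

(** The integrand is the real part of [e^{-ipa} e^{ipcX_j}], so a bound uniform in [a] is expected;
    the factor 2 comes from estimating the real and imaginary parts of the coefficient
    separately. *)
Lemma normr_integral_cos_le (p : int) (j : nat) (a : R) :
  `|\int[P]_w cos (p%:~R * (c * X j w - a))| <=
  2 * ComplexField.Normc.normc (char_coeff c X p j).
Proof.
have mY : measurable_fun setT (fun w => c * p%:~R * X j w).
  by apply: measurable_funM => //; exact: measurable_funP.
have icos : P.-integrable setT (EFin \o (fun w => cos (c * p%:~R * X j w))).
  apply: (@bounded_integrable _ _ R _ _ _ _ _ 1) => // [|w _]; last exact: cos_max.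
  by apply: measurableT_comp => //; apply: continuous_measurable_fun; exact: continuous_cos.
have isin : P.-integrable setT (EFin \o (fun w => sin (c * p%:~R * X j w))).
  apply: (@bounded_integrable _ _ R _ _ _ _ _ 1) => // [|w _]; last exact: sin_max.
  by apply: measurableT_comp => //; apply: continuous_measurable_fun; exact: continuous_sin.
set b := p%:~R * a.
have -> : \int[P]_w cos (p%:~R * (c * X j w - a)) =
    cos b * complex.Re (char_coeff c X p j) + sin b * complex.Im (char_coeff c X p j).
  have -> : complex.Re (char_coeff c X p j) = \int[P]_w cos (c * p%:~R * X j w).
    by rewrite /= unlock.
  have -> : complex.Im (char_coeff c X p j) = \int[P]_w sin (c * p%:~R * X j w).
    by rewrite /= unlock.
  rewrite -!RintegralZl// -RintegralD//; last 2 first.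
  - exact (integrableZl measurableT (cos b) icos).
  - exact (integrableZl measurableT (sin b) isin).
  apply: eq_Rintegral => w _; rewrite mulrC -[cos b * _]mulrC [sin b * _]mulrC -cosB.
  by congr cos; rewrite /b; ring.
set z := char_coeff _ _ _ _.
rewrite (le_trans (ler_normD _ _))// !normrM.
have h1 : `|cos b| * `|complex.Re z| <= 1 * ComplexField.Normc.normc z.
  by rewrite ler_pM// ?cos_max// Re_le_normc.
have h2 : `|sin b| * `|complex.Im z| <= 1 * ComplexField.Normc.normc z.
  by rewrite ler_pM// ?sin_max// Im_le_normc.
lra.
Qed.

Hypothesis X_coeff : forall k : int, k != 0 ->
  (fun N : nat => N%:R^-1 *
     \sum_(1 <= j < N.+1) ComplexField.Normc.normc (char_coeff c X k j))
    @ \oo --> (0 : R).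

Lemma weyl_criterion (y : nat -> R) (g : R -> R) :
  cbounded g -> periodic g (2 * pi) ->
  (fun N : nat => N%:R^-1 * \sum_(1 <= j < N.+1) \int[P]_w g (y j + c * X j w))
    @ \oo --> circle_mean g.
Proof.
have mY j : measurable_fun setT (fun w => y j + c * X j w).
  apply: measurable_funD => //; apply: measurable_funM => //; exact: measurable_funP.
apply: (@fejer_criterion _ (fun N f => N%:R^-1 *
    \sum_(1 <= j < N.+1) \int[P]_w f (y j + c * X j w)) (@circle_mean R)).
- move=> N; apply: bounded_functional_average => j.
  have := @bounded_functional_Rintegral _ _ R P setT measurableT PT_fin _ 1 (mY j).
  rewrite mul1r [X in fine X]probability_setT => /(_ ler01 (lexx _)).
  by under [X in bounded_functional X]eq_fun do rewrite mul1r.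
- exact: bounded_functional_circle_mean.
move=> p a; rewrite circle_mean_cos; have [->|p0] := eqVneq p 0.
  (* For [p = 0] the average equals 1 only from [N = 1] on. *)
  apply: cvg_near_cst; near=> N.
  rewrite (eq_bigr (fun=> 1)) => [|j _].
    have N0 : N%:R != 0 :> R by rewrite pnatr_eq0 -lt0n; near: N; exact: nbhs_infty_gt.
    by rewrite sumr_const_nat subn1/= mulVf.
  under eq_Rintegral do rewrite mul0r cos0.
  by rewrite Rintegral_cst// mul1r [X in fine X]probability_setT.
apply/cvgr0Pnorm_le => e e0.
have e20 : 0 < e / 2 by rewrite divr_gt0.
have /cvgr0Pnorm_le /(_ _ e20) := X_coeff p0.
apply: filterS => N.
rewrite normrM ger0_norm ?invr_ge0// [X in _ * X]ger0_norm; last first.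
  by apply: sumr_ge0 => j _; rewrite (le_trans _ (Re_le_normc _)).
move=> h; rewrite normrM ger0_norm ?invr_ge0//.
apply: (@le_trans _ _ (N%:R^-1 *
    \sum_(1 <= j < N.+1) 2 * ComplexField.Normc.normc (char_coeff c X p j))).
  rewrite ler_wpM2l ?invr_ge0// (le_trans (ler_norm_sum _ _ _))//.
  apply: ler_sum => j _.
  (* The deterministic phase [y j] is absorbed into the shift, which may vary with [j] because the
     bound does not see it. *)
  have := normr_integral_cos_le p j (a - y j).
  by under eq_Rintegral do rewrite opprB addrA [_ + y j]addrC.
by rewrite -mulr_sumr mulrCA mulrC -ler_pdivlMr.
Unshelve. all: end_near. Qed.

End weyl_criterion.

(** * Measurability on the plane *)

(** Second countability: an open set is the countable union of the rational boxes inside it, and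
    boxes lie in the product sigma-algebra. *)
Lemma open_measurable2 {R : realType} (U : set (R * R)) :
  open U -> measurable U.
Proof.
move=> oU.
pose box (a b : rat) (n : nat) : set (R * R) :=
  ball (ratr a : R) n.+1%:R^-1 `*` ball (ratr b : R) n.+1%:R^-1.
have -> : U = \bigcup_(a : rat) \bigcup_(b : rat) \bigcup_(n : nat)
    (if `[< box a b n `<=` U >] then box a b n else set0).
  apply/seteqP; split => [x Ux|x [a _ [b _ [n _]]]]; last first.
    by case: asboolP => // h /h.
  have /nbhs_ballP[r /= r0 xr] : nbhs x U by exact: open_nbhs_nbhs.
  (* Two points of a box of radius [1 / (n + 1)] are at distance below [2 / (n + 1) < r], so a box
     containing [x] stays inside [U]. *)
  pose n := Num.truncn (2 / r).
  have n0 : 0 < n.+1%:R^-1 :> R by rewrite invr_gt0.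
  have nr : n.+1%:R^-1 + n.+1%:R^-1 < r.
    have := truncnS_gt (2 / r); rewrite -/n ltr_pdivrMr// => h.
    by rewrite -mulr2n -[ltLHS]mulr_natr mulrC ltr_pdivrMr// mulrC.
  have near_rat (t : R) : exists a : rat, ball (ratr a : R) n.+1%:R^-1 t.
    have [|a] := @rat_in_itvoo _ (t - n.+1%:R^-1) (t + n.+1%:R^-1).
      by rewrite ltrD2l gtrN.
    rewrite in_itv/= => ha; exists a; rewrite /ball/= distrC ltr_distl.
    by move: ha => /andP[h1 h2]; rewrite ltrBlDr h2 -ltrBlDr h1.
  have [a xa] := near_rat x.1; have [b xb] := near_rat x.2.
  exists a => //; exists b => //; exists n => //; case: asboolP => [_|]; first by split.
  case=> z [/= za zb]; apply: xr; split; apply: (le_ball (ltW nr)).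
    exact: ball_triangle (ball_sym xa) za.
  exact: ball_triangle (ball_sym xb) zb.
apply: bigcupT_measurable_rat => a; apply: bigcupT_measurable_rat => b.
apply: bigcupT_measurable => n; case: asboolP => // _.
by apply: measurableX; apply: open_measurable; exact: ball_open.
Qed.

Lemma open_continuous_measurable_fun2 {R : realType} (D : set (R * R)) (f : R * R -> R) :
  open D -> {in D, continuous f} -> measurable_fun D f.
Proof.
move=> oD; rewrite -(continuous_open_subspace f oD) => /continuousP cf.
apply: (measurability _ (RGenOpens.measurableE R)) => //.
move=> _ [_ [a [b ->] <-]].
have oab : open `]a, b[%classic by exact: interval_open.
have := cf _ oab; rewrite -> open_subspaceP => -[V oV VD].
by rewrite setIC -VD; apply: measurableI; exact: open_measurable2.
Qed.

(** A derivative need not be continuous, but it is the pointwise limit of difference quotients with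
    steps [1 / (n + 1)]. Extending [f] by zero gives a meaning to the quotients whose second point
    leaves [D]. *)
Lemma measurable_derivative {R : realType} (D : set R) (f f' : R -> R) :
  open D -> (forall x, D x -> is_derive x 1 f (f' x)) -> measurable_fun D f'.
Proof.
move=> oD df; have mD := open_measurable oD.
have cf : {in D, continuous f}.
  move=> x; rewrite inE => /df [dfx _].
  by apply: differentiable_continuous; apply/derivable1_diffP.
have mf : measurable_fun setT (f \_ D).
  exact: (iffLR (measurable_restrictT f mD) (open_continuous_measurable_fun oD cf)).
refine (@measurable_fun_cvg _ _ R D
  (fun n x => n.+1%:R * ((f \_ D) (x + n.+1%:R^-1) - (f \_ D) x)) f' _ _).
  move=> n; apply: measurable_funTS; apply: measurable_funM => //.
  apply: measurable_funB => //; apply: measurableT_comp => //.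
  exact: measurable_funD.
move=> x Dx; have [dfx dv] := df _ Dx.
have {}dfx : h^-1 *: ((f \o shift x) (h *: (1 : R)) - f x) @[h --> 0^'] --> f' x.
  by rewrite -dv; exact: dfx.
have h0 : (fun n => n.+1%:R^-1 : R) @ \oo --> 0^'.
  move=> A /= hA; have : \forall n \near \oo, n.+1%:R^-1 != 0 :> R -> A n.+1%:R^-1.
    exact: (@cvg_harmonic R _ hA).
  by apply: (@filterS _ \oo) => n; apply; rewrite invr_eq0 pnatr_eq0.
have := cvg_comp _ _ h0 dfx.
apply: cvg_trans; apply: near_eq_cvg; near=> n => /=.
rewrite invrK /GRing.scale/= mulr1 [_ + x]addrC; congr (_ * (_ - _)).
  (* Since [D] is open, the second point eventually lies in [D], where the extension agrees with
     [f]. *)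
  rewrite patchE mem_set//; near: n.
  have : (fun n => x + n.+1%:R^-1 : R) @ \oo --> x.
    by rewrite -[X in _ --> X]addr0; apply: cvgD; [exact: cvg_cst|exact: cvg_harmonic].
  by apply; exact: open_nbhs_nbhs.
by rewrite patchE mem_set.
Unshelve. all: end_near. Qed.

(** * Exchanging expectation and phase average *)

Section average_exchange.
Context {d d' : measure_display} {W : measurableType d} {T : measurableType d'}.
Context {R : realType}.
Variables (P : probability W R) (mu : {sigma_finite_measure set T -> \bar R}).
Variables (D : set T) (rho : T -> R).
Hypotheses (mD : measurable D) (irho : mu.-integrable D (EFin \o rho)).

(** With the density extended by zero, Fubini can be applied on the full product. *)
Let r := rho \_ D.

Let ir : mu.-integrable setT (EFin \o r).
Proof.
by rewrite -restrict_EFin; exact/(integrable_mkcond (EFin \o rho) mD).1.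
Qed.

Let mr : measurable_fun setT r.
Proof. by apply/measurable_EFinP; exact: measurable_int ir. Qed.

Let PT_fin : (P setT < +oo)%E.
Proof. by rewrite probability_setT ltry. Qed.

Let restrict_mul (u : T -> R) : (fun z => u z * rho z) \_ D = (fun z => u z * r z).
Proof.
by apply/funext => z; rewrite /r !patchE; case: ifPn => // _; rewrite mulr0.
Qed.

Let integrable_mul (u : T -> R) (B : R) :
  measurable_fun setT u -> (forall z, `|u z| <= B) ->
  mu.-integrable setT (EFin \o (fun z => u z * r z)).
Proof.
move=> mu_ uB.
apply: (le_integrable measurableT _ _ (integrableZl measurableT B ir)).
  by apply/measurable_EFinP; exact: measurable_funM.
move=> z _; rewrite /= lee_fin !normrM ler_wpM2r//.
by rewrite (le_trans (uB z))// ler_norm.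
Qed.

Section one.
Variables (h : W * T -> R) (B : R).
Hypotheses (mh : measurable_fun setT h) (hB : forall x, `|h x| <= B).

Let f (x : W * T) : \bar R := (h x * r x.2)%:E.

Let mf : measurable_fun setT f.
Proof.
apply/measurable_EFinP; apply: measurable_funM => //.
by apply: measurableT_comp => //; exact: measurable_snd.
Qed.

Let mhw w : measurable_fun setT (fun z => h (w, z)).
Proof. by apply: measurableT_comp => //; exact: measurable_pair1. Qed.

Let mhz z : measurable_fun setT (fun w => h (w, z)).
Proof. by apply: measurableT_comp => //; exact: measurable_pair2. Qed.

Let ihz z : P.-integrable setT (EFin \o (fun w => h (w, z))).
Proof.
exact: (@bounded_integrable _ _ R P setT measurableT PT_fin _ B (mhz z)).
Qed.

(** By Tonelli: for each [w] the inner integral is at most that of [|B * r|], a finite constant, and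
    [P] has mass 1. *)
Let intf : (P \x mu)%E.-integrable setT f.
Proof.
apply/integrable12ltyP => //.
have /integrableP[_ rfin] := integrableZl measurableT B ir.
apply: (@le_lt_trans _ _ (\int[P]_w (\int[mu]_z `|B%:E * (r z)%:E|))%E).
  apply: ge0_le_integral => //.
  - by move=> w _; exact: integral_ge0.
  - apply: (measurable_fun_fubini_tonelli_F (abse \o f)) => //=.
    exact: measurableT_comp.
  - move=> w _; apply: ge0_le_integral => //.
    + by apply: measurableT_comp => //; exact: measurableT_comp.
    + by apply/measurable_EFinP; apply: measurableT_comp => //; exact: measurable_funM.
    + move=> z _; rewrite /f/= lee_fin !normrM ler_wpM2r//.
      by rewrite (le_trans (hB _))// ler_norm.
by rewrite integral_cst// [X in (_ * X)%E]probability_setT mule1.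
Qed.

Let inner w : (\int[mu]_(z in D) (h (w, z) * rho z))%:E = fubini_F mu f w.
Proof.
rewrite Rintegral_mkcond (restrict_mul (fun z => h (w, z))) /Rintegral fineK//.
by apply: integrable_fin_num => //; exact: integrable_mul (mhw w) (fun z => hB (w, z)).
Qed.

Let inner' z : (\int[P]_w h (w, z) * r z)%:E = fubini_G P f z.
Proof.
rewrite -RintegralZr// /Rintegral fineK//.
exact: (integrable_fin_num _ (integrableZr measurableT (r z) (ihz z))).
Qed.

Lemma integrable_inner_average :
  P.-integrable setT (fun w => (\int[mu]_(z in D) (h (w, z) * rho z))%:E).
Proof.
under eq_fun do rewrite inner.
exact: integrable_fubini_F.
Qed.

(** Measurability is a by-product of Fubini; the density remains as a factor because it is part of
    the function integrated over the product. *)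
Lemma measurable_inner_expectation :
  measurable_fun setT (fun z => \int[P]_w h (w, z) * (rho \_ D) z).
Proof.
apply/measurable_EFinP; rewrite (_ : _ \o _ = fubini_G P f).
  exact: (measurable_fubini_G intf).
by apply/funext => z /=; rewrite inner'.
Qed.

Lemma normr_inner_expectation z : `|\int[P]_w h (w, z)| <= B.
Proof.
have := @normr_Rintegral_le _ _ R P setT measurableT PT_fin _ B (mhz z) (fun w _ => hB (w, z)).
by rewrite [X in fine X]probability_setT mulr1; apply.
Qed.

Lemma exchange_average :
  \int[P]_w (\int[mu]_(z in D) (h (w, z) * rho z)) =
  \int[mu]_(z in D) (\int[P]_w h (w, z) * rho z).
Proof.
rewrite [RHS]Rintegral_mkcond (restrict_mul (fun z => \int[P]_w h (w, z))).
rewrite {1}/Rintegral [in RHS]/Rintegral.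
under eq_integral do rewrite inner.
under [in RHS]eq_integral do rewrite inner'.
by rewrite (Fubini intf).
Qed.

End one.
End average_exchange.

(** * Finite sums and dominated convergence *)

Lemma integrable_sum_EFin {d : measure_display} {T : measurableType d} {R : realType}
    (mu : {measure set T -> \bar R}) (D : set T) (I : Type) (s : seq I)
    (F : I -> T -> R) :
  measurable D -> (forall i, mu.-integrable D (EFin \o F i)) ->
  mu.-integrable D (EFin \o (fun x => \sum_(i <- s) F i x)).
Proof.
move=> mD iF; rewrite (_ : _ \o _ = fun x => (\sum_(i <- s) (F i x)%:E)%E).
  by apply: integrable_sum => // i _; exact: iF.
by apply/funext => x /=; rewrite sumEFin.
Qed.

Lemma Rintegral_sum {d : measure_display} {T : measurableType d} {R : realType}
    (mu : {measure set T -> \bar R}) (D : set T) (I : Type) (s : seq I)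
    (F : I -> T -> R) :
  measurable D -> (forall i, mu.-integrable D (EFin \o F i)) ->
  \int[mu]_(x in D) (\sum_(i <- s) F i x) = \sum_(i <- s) \int[mu]_(x in D) F i x.
Proof.
move=> mD iF; elim: s => [|i s IH].
  under eq_Rintegral do rewrite big_nil.
  by rewrite Rintegral_cst// mul0r big_nil.
under eq_Rintegral do rewrite big_cons.
by rewrite RintegralD ?IH ?big_cons//; exact: integrable_sum_EFin.
Qed.

(** The dominating function is [B * |rho|]. Measurability is asked of the products [u n z * rho z],
    the form in which Fubini supplies it; the limit inherits it. *)
Lemma dominated_cvg_mul {d : measure_display} {T : measurableType d} {R : realType}
    (mu : {measure set T -> \bar R}) (D : set T) (rho : T -> R)
    (u : nat -> T -> R) (v : T -> R) (B : R) :
  measurable D -> mu.-integrable D (EFin \o rho) ->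
  (forall n, measurable_fun D (fun z => u n z * rho z)) ->
  (forall n z, `|u n z| <= B) ->
  (forall z, D z -> u ^~ z @ \oo --> v z) ->
  (fun n => \int[mu]_(z in D) (u n z * rho z)) @ \oo -->
    \int[mu]_(z in D) (v z * rho z).
Proof.
move=> mD irho mu_ uB uv.
have uvr z : D z -> (fun n => (u n z * rho z)%:E) @ \oo --> (v z * rho z)%:E.
  by move=> Dz; apply: cvg_EFin; [exact: nearW|apply: cvgMl; exact: uv].
have [] := @dominated_convergence _ T R mu D mD (fun n z => (u n z * rho z)%:E)
  (fun z => (v z * rho z)%:E) (fun z => (B * `|rho z|)%:E).
- by move=> n; apply/measurable_EFinP.
- apply: emeasurable_fun_cvg uvr => n; exact/measurable_EFinP.
- by apply: aeW => z; exact: uvr.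
- by under eq_fun do rewrite EFinM; apply: integrableZl => //; exact: integrable_abse irho.
- by apply: aeW => z n _; rewrite lee_fin normrM ler_wpM2r.
move=> iv _ cv; apply: fine_cvg; rewrite /Rintegral fineK//.
exact: integrable_fin_num.
Qed.

Section average_limit.
Context {d d' : measure_display} {W : measurableType d} {T : measurableType d'}.
Context {R : realType}.
Variables (P : probability W R) (mu : {sigma_finite_measure set T -> \bar R}).
Variables (D : set T) (rho : T -> R).
Hypotheses (mD : measurable D) (irho : mu.-integrable D (EFin \o rho)).
Variables (h : nat -> W * T -> R) (B : R).
Hypotheses (mh : forall j, measurable_fun setT (h j)) (hB : forall j x, `|h j x| <= B).

Let e j z := \int[P]_w h j (w, z).

Let me j : measurable_fun D (fun z => e j z * rho z).
Proof.
have m : measurable_fun D (fun z => e j z * (rho \_ D) z).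
  exact: (measurable_funTS (measurable_inner_expectation P mD irho (mh j) (hB j))).
by apply: eq_measurable_fun m => z zD; rewrite patchE zD.
Qed.

Let ie j : mu.-integrable D (EFin \o (fun z => e j z * rho z)).
Proof.
apply: (le_integrable mD _ _ (integrableZl mD B irho)).
  by apply/measurable_EFinP; exact: me.
move=> z _; rewrite /= lee_fin !normrM ler_wpM2r//.
by rewrite (le_trans (normr_inner_expectation _ (mh j) (hB j) _))// ler_norm.
Qed.

Lemma cvg_expected_average (v : T -> R) :
  (forall z, D z -> (fun N => N%:R^-1 * \sum_(1 <= j < N.+1) \int[P]_w h j (w, z))
     @ \oo --> v z) ->
  (fun N => \int[P]_w (N%:R^-1 *
     \sum_(1 <= j < N.+1) \int[mu]_(z in D) (h j (w, z) * rho z))) @ \oo -->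
  \int[mu]_(z in D) (v z * rho z).
Proof.
move=> hv; pose u N z := N%:R^-1 * \sum_(1 <= j < N.+1) e j z.
have isum N : mu.-integrable D
    (EFin \o (fun z => \sum_(1 <= j < N.+1) e j z * rho z)).
  by apply: integrable_sum_EFin => //; exact: ie.
have uE N : (fun z => u N z * rho z) =
    (fun z => N%:R^-1 * (\sum_(1 <= j < N.+1) e j z * rho z)).
  by apply/funext => z; rewrite /u -mulrA mulr_suml.
have -> : (fun N => \int[P]_w (N%:R^-1 *
     \sum_(1 <= j < N.+1) \int[mu]_(z in D) (h j (w, z) * rho z))) =
    (fun N => \int[mu]_(z in D) (u N z * rho z)).
  apply/funext => N.
  have iin j := integrable_inner_average P mD irho (mh j) (hB j).
  rewrite RintegralZl//; last by apply: integrable_sum_EFin => // j; exact: iin.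
  rewrite Rintegral_sum//.
  rewrite uE RintegralZl// Rintegral_sum//.
  by congr (_ * _); apply: eq_bigr => j _; rewrite (exchange_average P mD irho (mh j) (hB j)).
apply: (@dominated_cvg_mul _ _ _ _ _ _ u _ B) => //.
- move=> N; rewrite uE; apply: measurable_funM => //.
  by apply/measurable_EFinP; exact: measurable_int (isum N).
- move=> N z; rewrite /u.
  (* At [N = 0] the average is 0, and [0 <= B] is read off from the bound on [h 0]. *)
  have [->|N0] := posnP N.
    rewrite invr0 mul0r normr0.
    exact: (le_trans (normr_ge0 _) (normr_inner_expectation P (mh 0%N) (hB 0%N) z)).
  rewrite normrM ger0_norm ?invr_ge0// mulrC ler_pdivrMr ?ltr0n//.
  rewrite (le_trans (ler_norm_sum _ _ _))//.
  apply: (@le_trans _ _ (\sum_(1 <= j < N.+1) B)).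
    by apply: ler_sum => j _; exact: (normr_inner_expectation P (mh j) (hB j) z).
  by rewrite sumr_const_nat subn1 mulr_natr.
Qed.

End average_limit.

(** * Real and imaginary parts *)

(** A Boolean selector, so that each argument is made once for both parts. *)
Definition component {R : realType} (b : bool) (z : R[i]) : R :=
  if b then complex.Re z else complex.Im z.

Lemma component_le_normc {R : realType} b (z : R[i]) :
  `|component b z| <= ComplexField.Normc.normc z.
Proof. by case: b; [exact: Re_le_normc|exact: Im_le_normc]. Qed.

(** The norm of [R[i]] takes values in [R[i]] itself; this passes to the real modulus. *)
Lemma normc_complexE {R : realType} (z : R[i]) : `|z| = (ComplexField.Normc.normc z)%:C.
Proof. by []. Qed.

Lemma componentB {R : realType} b (z z' : R[i]) :
  component b (z - z') = component b z - component b z'.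
Proof. by case: b; case: z; case: z'. Qed.

Lemma component_sum {R : realType} b (I : Type) (s : seq I) (F : I -> R[i]) :
  component b (\sum_(i <- s) F i) = \sum_(i <- s) component b (F i).
Proof.
apply: (big_morph (component b)) => [z z'|]; last by case: b.
by case: b; case: z; case: z'.
Qed.

Lemma componentZl {R : realType} b (x : R) (z : R[i]) :
  component b (x%:C * z) = x * component b z.
Proof. by case: b; case: z => u v /=; rewrite mul0r ?subr0 ?addr0. Qed.

Lemma component_cintegral {R : realType} b d (T : measurableType d)
    (mu : {measure set T -> \bar R}) (D : set T) (f : T -> R[i]) :
  component b (cintegral mu D f) = \int[mu]_(x in D) component b (f x).
Proof. by case: b. Qed.

Lemma component_cexpectation {R : realType} b d (T : measurableType d)
    (P : probability T R) (Y : T -> R[i]) :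
  component b (cexpectation P Y) = \int[P]_w component b (Y w).
Proof. by case: b; rewrite /= unlock. Qed.

Lemma continuous_component {R : realType} b :
  continuous (component b : R[i]^o -> R).
Proof.
move=> z; have FF : Filter (nbhs (z : R[i]^o)) by exact: nbhs_filter.
apply/cvgrPdist_lt => e e0; have e0' : 0 < e%:C by rewrite ltcR.
have : \forall x \near (z : R[i]^o), `|z - x| < e%:C.
  by apply/nbhs_ballP; exists e%:C.
apply: filterS => x.
rewrite normc_complexE ltcR -componentB; apply: le_lt_trans.
exact: component_le_normc.
Qed.

Lemma cvg_component {R : realType} (f : nat -> R[i]) (l : R[i]) :
  (forall b, (fun n => component b (f n)) @ \oo --> component b l) ->
  (f : nat -> R[i]^o) @ \oo --> (l : R[i]^o).
Proof.
(* A positive [e] in [R[i]] has zero imaginary part, so the tolerance is a real number. *)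
move=> fl; apply/cvgrPdist_lt => -[e e'] /[!ltcE]/= /andP[/eqP-> e0].
have e20 : 0 < e / 2 by rewrite divr_gt0.
have /cvgrPdist_lt/(_ _ e20) flr := fl true.
have /cvgrPdist_lt/(_ _ e20) fli := fl false.
near=> n; rewrite normc_complexE ltcR.
apply: (@le_lt_trans _ _ (`|component true (l - f n)| + `|component false (l - f n)|)).
  case: (l - f n) => x y /=.
  rewrite -[leRHS]ger0_norm ?addr_ge0// -[leRHS]sqrtr_sqr ler_sqrt ?sqr_ge0//.
  by rewrite sqrrD !real_normK ?num_real// -addrA lerD2l lerDr mulrn_wge0 ?mulr_ge0.
rewrite !componentB (splitr e); apply: ltrD; near: n; first exact: flr.
exact: fli.
Unshelve. all: end_near. Qed.

Lemma bounded_component {R : realType} (T : Type) (A : set T) (G : T -> R[i]) :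
  [bounded (G x : R[i]^o) | x in A] ->
  exists B : R, forall b x, A x -> `|component b (G x)| <= B.
Proof.
move=> [M [_ /(_ (M + 1) (ltr_pwDr ltr01 (lexx _))) GM]].
exists (complex.Re (M + 1)) => b x Ax.
have := GM x Ax; rewrite /= normc_complexE lecE => /andP[_ /=].
exact: le_trans (component_le_normc _ _).
Qed.

(** * Phase averages *)

(** Both exhaustions are taken nondecreasing, so that the diagonal products [F n] times [G n]
    already cover the plane. *)
Lemma product_measure_sigma_finite d1 d2 (T1 : measurableType d1)
    (T2 : measurableType d2) (R : realType)
    (m1 : {sigma_finite_measure set T1 -> \bar R})
    (m2 : {sigma_finite_measure set T2 -> \bar R}) :
  sigma_finite setT (m1 \x m2)%E.
Proof.
have /sigma_finiteP[F [TF ndF Foo]] := sigma_finiteT m1.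
have /sigma_finiteP[G [TG ndG Goo]] := sigma_finiteT m2.
exists (fun n => F n `*` G n) => [|k].
  rewrite -setXTT TF TG; apply/seteqP; split=> [[x y] [[n _ Fx] [k _ Gy]]|].
    exists (maxn n k) => //; split.
      by have /subsetPset := ndF _ _ (leq_maxl n k); exact.
    by have /subsetPset := ndG _ _ (leq_maxr n k); exact.
  by move=> [x y] [n _ [/= Fx Gy]]; split; exists n.
have [mF Fk] := Foo k; have [mG Gk] := Goo k; split; first exact: measurableX.
by rewrite product_measure1E// lte_mul_pinfty// ge0_fin_numE.
Qed.

(* The library instance that makes [m1 \x m2] a sigma-finite measure is shadowed by
   the one for (sub)probabilities, hence the explicit packing. *)
Definition lebesgue_measure2 {R : realType} :
    {sigma_finite_measure set (measurableTypeR R * measurableTypeR R)%type -> \bar R} :=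
  HB.pack (@lebesgue_measure R \x @lebesgue_measure R)%E
    (Measure_isSigmaFinite.Build _ _ _ (@lebesgue_measure R \x @lebesgue_measure R)%E
      (product_measure_sigma_finite (@lebesgue_measure R) (@lebesgue_measure R))).

Lemma measurable_phase_space {R : realType} (Omega : set R) :
  open Omega -> measurable (phase_space Omega).
Proof.
move=> oO; apply: measurableX; first exact: open_measurable.
exact: measurable_circle.
Qed.

(** Nonnegativity identifies the integral of the absolute value with the total mass 1; measurability
    is read off from membership in [Lfun]. *)
Lemma L2_density_integrable {R : realType} (Omega : set R) (rho : R * R -> R) :
  open Omega -> L2_density Omega rho ->
  phase_measure.-integrable (phase_space Omega) (EFin \o rho).
Proof.
move=> oO [_ rho0 rhoL rho1]; have mD := measurable_phase_space oO.
have mr : measurable_fun (phase_space Omega) (EFin \o rho).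
  apply/measurable_EFinP; apply: (iffRL (measurable_restrictT rho mD)).
  by move: rhoL; rewrite inE => /andP[]; rewrite !inE.
apply/integrableP; split => //.
rewrite (_ : integral _ _ _ = 1%E) ?ltry// -rho1; apply: eq_integral => z.
by rewrite inE => Dz; rewrite /= ger0_norm// rho0.
Qed.

(** * The limit for a real observable *)

Section real_observable.
Variables (R : realType) (Omega : set R) (omega : R -> R) (g : R * R -> R) (B : R).
Hypotheses (oO : open Omega) (momega : measurable_fun Omega omega).
Hypotheses (pg : angle_periodic Omega g)
  (cg : {within Omega `*` [set: R], continuous g})
  (gB : forall x, (Omega `*` [set: R]) x -> `|g x| <= B).

Let oOT : open (Omega `*` [set: R]).
Proof.
rewrite (_ : _ `*` _ = fst @^-1` Omega); last first.
  by apply/seteqP; split => [x []|x /= Ox].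
by apply: open_comp => // x _; exact: cvg_fst.
Qed.

Let cg_in : {in Omega `*` [set: R], continuous g}.
Proof. by rewrite -(continuous_open_subspace g oOT). Qed.

(** Fubini is applied to globally measurable bounded functions, whereas [g] and [omega] are
    controlled only over [Omega]; both are extended by zero. *)
Let g0 := g \_ (Omega `*` [set: R]).
Let om := omega \_ Omega.

Let mg0 : measurable_fun setT g0.
Proof.
have mOT := open_measurable2 oOT.
exact: (iffLR (measurable_restrictT g mOT) (open_continuous_measurable_fun2 oOT cg_in)).
Qed.

Let mom : measurable_fun setT om.
Proof. exact: (iffLR (measurable_restrictT omega (open_measurable oO)) momega). Qed.

Let g0E I t : Omega I -> g0 (I, t) = g (I, t).
Proof. by move=> OI; rewrite /g0 patchE mem_set. Qed.

(** The maximum with 0 covers an empty [Omega], for which [gB] does not force [B] to be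
    nonnegative. *)
Let B0 z : `|g0 z| <= Num.max B 0.
Proof.
rewrite /g0 patchE; case: ifPn => [zO|_]; last by rewrite normr0 le_max lexx orbT.
by rewrite le_max gB//; rewrite inE in zO.
Qed.

Context {d : measure_display} {W : measurableType d}.
Variables (P : probability W R) (c : R) (X : nat -> {RV P >-> R}).
Hypothesis X_coeff : forall k : int, k != 0 ->
  (fun N : nat => N%:R^-1 *
     \sum_(1 <= j < N.+1) ComplexField.Normc.normc (char_coeff c X k j))
    @ \oo --> (0 : R).
Variable rho : R * R -> R.
Hypothesis irho : phase_measure.-integrable (phase_space Omega) (EFin \o rho).

Let h j (x : W * (measurableTypeR R * measurableTypeR R)) : R :=
  g0 (x.2.1, x.2.2 + j%:R * om x.2.1 + c * X j x.1).

Let mh j : measurable_fun setT (h j).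
Proof.
have m1 : measurable_fun setT
    (fun x : W * (measurableTypeR R * measurableTypeR R) => x.2.1 : R).
  exact: (measurableT_comp measurable_fst measurable_snd).
have m2 : measurable_fun setT
    (fun x : W * (measurableTypeR R * measurableTypeR R) => x.2.2 : R).
  exact: (measurableT_comp measurable_snd measurable_snd).
apply: (measurableT_comp mg0); apply: measurable_fun_pair => //.
apply: measurable_funD.
  apply: measurable_funD => //; apply: measurable_funM => //.
  exact: (measurableT_comp mom m1).
apply: measurable_funM => //.
by apply: measurableT_comp => //; exact: measurable_funP.
Qed.

Lemma cvg_expected_phase_average :
  (fun N => \int[P]_w (N%:R^-1 * \sum_(1 <= j < N.+1)
     \int[phase_measure]_(z in phase_space Omega)
       (g (time_map omega c j (X j w) z) * rho z))) @ \oo -->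
  \int[phase_measure]_(z in phase_space Omega)
     (circle_mean (fun t => g (z.1, t)) * rho z).
Proof.
have mD := measurable_phase_space oO.
pose v (z : R * R) := circle_mean (fun t => g (z.1, t)).
have key : (forall z, phase_space Omega z -> (fun N => N%:R^-1 *
      \sum_(1 <= j < N.+1) \int[P]_w h j (w, z)) @ \oo --> v z) ->
    (fun N => \int[P]_w (N%:R^-1 * \sum_(1 <= j < N.+1)
      \int[phase_measure]_(z in phase_space Omega) (h j (w, z) * rho z))) @ \oo -->
    \int[phase_measure]_(z in phase_space Omega) (v z * rho z).
  exact: (@cvg_expected_average _ _ W _ R P lebesgue_measure2 (phase_space Omega) rho mD irho
    h (Num.max B 0) mh (fun j x => B0 _) v).
(* The motion keeps [I] fixed, so a point over [Omega] never meets the extensions by zero, even when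
   its angle leaves [[0, 2 pi[]. *)
have hE j w z : phase_space Omega z ->
    h j (w, z) = g (time_map omega c j (X j w) z).
  by case: z => I t [/= OI _]; rewrite /h/= g0E// /om patchE mem_set.
rewrite [X in X @ _ --> _](_ : _ = fun N => \int[P]_w (N%:R^-1 * \sum_(1 <= j < N.+1)
      \int[phase_measure]_(z in phase_space Omega) (h j (w, z) * rho z))); last first.
  apply/funext => N; apply: eq_Rintegral => w _; congr (_ * _).
  apply: eq_bigr => j _; apply: eq_Rintegral => z; rewrite inE => Dz.
  by rewrite hE.
apply: key => -[I t] [/= OI _].
have cgI : cbounded (fun t => g (I, t)).
  split; last by exists B => s; exact: gB.
  move=> s; apply: (@continuous_comp _ _ _ (fun t => (I, t)) g).
    exact: (cvg_pair (@cvg_cst _ I _ _ _) (@cvg_id _ (nbhs s))).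
  have sI : (I, s) \in Omega `*` [set: R] by rewrite inE.
  exact: (cg_in sI).
(* With [(I, t)] fixed, the phases [t + j omega(I)] form a deterministic sequence, as the criterion
   allows. *)
have := weyl_criterion X_coeff (fun j => t + j%:R * om I) cgI (fun s => pg s OI).
apply: cvg_trans; apply: near_eq_cvg; apply: nearW => N.
congr (_ * _); apply: eq_bigr => j _; apply: eq_Rintegral => w _.
by rewrite /h/= g0E.
Qed.

End real_observable.

(** * Return to complex observables *)

Lemma component_phase_average {R : realType} b (Omega : set R) (rho : R * R -> R)
    (F : R * R -> R[i]) :
  component b (phase_average Omega rho F) =
  \int[phase_measure]_(z in phase_space Omega) (component b (F z) * rho z).
Proof.
rewrite /phase_average component_cintegral; apply: eq_Rintegral => z _.
by rewrite mulrC componentZl mulrC.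
Qed.

Lemma component_angle_average {R : realType} b (G : R * R -> R[i]) (I : R) :
  component b (angle_average G I) = circle_mean (fun t => component b (G (I, t))).
Proof. by rewrite /angle_average componentZl component_cintegral. Qed.

Theorem theorem3p3 (R : realType)
  (Omega : set R) (Omega_open : open Omega) (Omega_bounded : bounded_set Omega)
  (H0 omega : R -> R)
  (omegaE : forall I : R, Omega I -> is_derive I 1 H0 (omega I))
  (nonresonance : forall (k m : int) (I : R), k != 0 -> Omega I ->
     k%:~R * omega I != 2 * m%:~R * pi)
  (G : R * R -> R[i]) (G_Cb : phase_Cb Omega G)
  (c : R) (c_gt0 : 0 < c)
  (d : measure_display) (W : measurableType d) (P : probability W R)
  (X : nat -> {RV P >-> R}) (Z : {RV P >-> (R * R)%type})
  (XZ_indep : process_independent X Z)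
  (X_coeff : forall k : int, k != 0 ->
     (fun N : nat => N%:R^-1 *
        \sum_(1 <= j < N.+1) ComplexField.Normc.normc (char_coeff c X k j))
       @ \oo --> (0 : R))
  (rho0 : R * R -> R) (rho0_L2 : L2_density Omega rho0)
  (Z_density : has_density Omega Z rho0) :
  (fun N : nat =>
     cexpectation P (time_average Omega omega c X rho0 G N) : R[i]^o) @ \oo -->
  (phase_average Omega rho0 (fun z => angle_average G z.1) : R[i]^o).
Proof.
have [pG cG bG] := G_Cb; have [B GB] := bounded_component bG.
have irho := L2_density_integrable Omega_open rho0_L2.
have momega := measurable_derivative Omega_open omegaE.
(* The density and the weights [1 / N] are real, so all averages commute with taking a component and
   the real case applies to [component b \o G]. *)
apply: cvg_component => b; rewrite component_phase_average.
under eq_Rintegral do rewrite component_angle_average.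
have -> : (fun N => component b (cexpectation P
    (time_average Omega omega c X rho0 G N))) = (fun N => \int[P]_w (N%:R^-1 * \sum_(1 <= j < N.+1)
    \int[phase_measure]_(z in phase_space Omega)
      (component b (G (time_map omega c j (X j w) z)) * rho0 z))).
  apply/funext => N; rewrite component_cexpectation; apply: eq_Rintegral => w _.
  rewrite /time_average (_ : N%:R^-1 = (N%:R^-1)%:C); last first.
    by rewrite fmorphV rmorph_nat.
  rewrite componentZl component_sum; congr (_ * _); apply: eq_bigr => j _.
  exact: component_phase_average.
apply: (@cvg_expected_phase_average R Omega omega (component b \o G) B) => //.
- by move=> I t OI /=; rewrite pG.
- move=> x; exact: (@continuous_comp _ _ _ (G : subspace _ -> R[i]^o) (component b)
    x (cG x) (@continuous_component R b (G x))).
- by move=> x Ox; exact: GB.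
Qed.
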